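(* Let $\mathcal{H}$ be a separable real Hilbert space, let $T\colon \mathcal{H} \to \ell_2$ be the (nonzero) analysis operator of some frame of $\mathcal{H}$, and let $\mathrm{Prox}\colon \ell_2\to\ell_2$ be an arbitrary proximity operator. Then $T^\dagger\,\mathrm{Prox}\,T$ is itself a proximity operator on $\mathcal{H}$ equipped with the norm $\|\cdot\|_{\mathcal{H}_T}$. In particular, if $\mathrm{Prox} := S_\lambda$ with $\lambda>0$, then for all $x \in \mathcal{H}$ $$T^\dagger S_\lambda(Tx) = \operatorname*{argmin}_{y\in\mathcal{H}} \bigl\{ \tfrac12\|x-y\|_{\mathcal{H}_T}^2 + f(y)\bigr\},$$ where $$f(y) := \frac{1}{\|T\|^2_{\mathcal{B}(\mathcal{H},\ell_2)}}\Bigl(\lambda\|\cdot\|_1 \,\square\, \bigl(\tfrac12\|\cdot\|_{\ell_2}^2 + \iota_{\mathcal{N}(T^* )}\bigr)\Bigr)(Ty).$$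
   Context: $\ell_2$ is the real Hilbert space of square summable sequences $c=\{c_k\}_{k\in\mathbb{N}}$ with norm $\|c\|_{\ell_2} = (\sum_k |c_k|^2)^{1/2}$. A sequence $\{x_k\}_{k\in\mathbb{N}}$ in $\mathcal{H}$ is a frame of $\mathcal{H}$ if there are constants $0<A\le B<\infty$ with $A\|x\|_{\mathcal{H}}^2 \le \sum_{k\in\mathbb{N}} |\langle x,x_k\rangle_{\mathcal{H}}|^2 \le B\|x\|_{\mathcal{H}}^2$ for all $x\in\mathcal{H}$; its analysis operator is $T\colon\mathcal{H}\to\ell_2$, $Tx = \{\langle x,x_k\rangle_{\mathcal{H}}\}_{k\in\mathbb{N}}$ (bounded, injective, with closed range). $T^\dagger$ is the Moore-Penrose inverse of $T$: $\{T^\dagger c\} = \{x\in\mathcal{H} : T^*Tx = T^*c\}\cap \mathcal{R}(T^* )$. $\mathcal{N}(\cdot)$ and $\mathcal{R}(\cdot)$ denote kernel and range. $P_{\mathcal{N}(T)}$ is the orthogonal projection onto $\mathcal{N}(T)$. The norm on $\mathcal{H}$ is $$\|x\|_{\mathcal{H}_T} = \Bigl(\|Tx\|_{\ell_2}^2/\|T\|^2_{\mathcal{B}(\mathcal{H},\ell_2)} + \|P_{\mathcal{N}(T)}x\|_{\mathcal{H}}^2\Bigr)^{1/2},$$ where $\|T\|_{\mathcal{B}(\mathcal{H},\ell_2)}$ is the operator norm; it comes from the inner product $\langle Tx,Ty\rangle_{\ell_2}/\|T\|^2_{\mathcal{B}(\mathcal{H},\ell_2)} + \langle x,P_{\mathcal{N}(T)}y\rangle_{\mathcal{H}}$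 and is equivalent to $\|\cdot\|_{\mathcal{H}}$ (the second summand vanishes for injective $T$). For a real Hilbert space $\mathcal{X}$, $\Gamma_0(\mathcal{X})$ is the set of proper, convex, lower semi-continuous functions $\mathcal{X}\to(-\infty,\infty]$; a map $\mathcal{X}\to\mathcal{X}$ is a proximity operator on $\mathcal{X}$ if it equals $x\mapsto \operatorname{argmin}_{y\in\mathcal{X}}\{\tfrac12\|x-y\|_{\mathcal{X}}^2+h(y)\}$ for some $h\in\Gamma_0(\mathcal{X})$. The soft shrinkage operator $S_\lambda$ acts componentwise on $\ell_2$ by $S_\lambda(t) = t-\lambda$ for $t>\lambda$, $S_\lambda(t)=0$ for $t\in[-\lambda,\lambda]$, $S_\lambda(t)=t+\lambda$ for $t<-\lambda$. $\|c\|_1=\sum_k|c_k|\in[0,\infty]$ for $c\in\ell_2$. The indicator function $\iota_S$ is $0$ on $S$ and $+\infty$ elsewhere. The infimal convolution is $(g\,\square\,h)(z) = \inf_{w}\{g(w)+h(z-w)\}$. *)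

(* Defs.v *)
From HB Require Import structures.
From mathcomp Require Import all_boot all_order all_algebra.
From mathcomp Require Import sesquilinear.
From mathcomp Require Import ring lra.
From mathcomp Require Import all_classical all_reals.
From mathcomp Require Import ereal topology tvs normedtype sequences.

Set Implicit Arguments.
Unset Strict Implicit.
Unset Printing Implicit Defensive.
Import Order.TTheory GRing.Theory Num.Theory.
Import numFieldNormedType.Exports.
Local Open Scope classical_set_scope.
Local Open Scope ring_scope.

HB.mixin Record CompleteNormedModule_isHilbert (R : realType) H
    & CompleteNormedModule R H := {
  inner : {dot H for (@idfun R)};
  inner_normE : forall x : H, inner x x = `|x| ^+ 2
}.

#[short(type="hilbertType")]
HB.structure Definition Hilbert (R : realType) :=
  {H of CompleteNormedModule R H & CompleteNormedModule_isHilbert R H}.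

Section dot_theory.
Context {R : rcfType} {V : lmodType R} (f : {dot V for (@idfun R)}).

Lemma dotC x y : f x y = f y x.
Proof. by rewrite hermC /= mul1r. Qed.

Lemma dot0r x : f x 0 = 0. Proof. exact: linear0. Qed.

Lemma dotDr x y z : f x (y + z) = f x y + f x z. Proof. exact: linearD. Qed.

Lemma dotZr x a y : f x (a *: y) = a * f x y.
Proof. by rewrite linearZ. Qed.

Lemma dot_ge0 x : 0 <= f x x.
Proof.
by have [->|/neq0_dnorm_gt0/ltW//] := eqVneq x 0; rewrite dot0r.
Qed.

Lemma dot_eq0 x : f x x = 0 -> x = 0.
Proof.
have [//|/neq0_dnorm_gt0 - /(_ _ f)] := eqVneq x 0.
by move=> /[swap] ->; rewrite ltxx.
Qed.

Lemma dotDD x y : f (x + y) (x + y) = f x x + 2 * f x y + f y y.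
Proof.
rewrite dotDr ![f (x + y) _]dotC !dotDr [f y x]dotC.
ring.
Qed.

Lemma dotZZ a x : f (a *: x) (a *: x) = a ^+ 2 * f x x.
Proof. by rewrite dotZr dotC dotZr mulrA. Qed.

Lemma dot_cauchy_schwarz x y : f x y <= Num.sqrt (f x x) * Num.sqrt (f y y).
Proof.
have [->|y0] := eqVneq y 0; first by rewrite !dot0r sqrtr0 mulr0.
have fy : 0 < f y y by exact: neq0_dnorm_gt0.
have := dot_ge0 (f y y *: x + - f x y *: y).
rewrite dotDD !dotZZ dotZr [f (_ *: _) y]dotC dotZr [f y x]dotC.
have -> : f y y ^+ 2 * f x x + 2 * (- f x y * (f y y * f x y)) +
  (- f x y) ^+ 2 * f y y = f y y * (f x x * f y y - f x y ^+ 2) by ring.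
rewrite pmulr_rge0// subr_ge0 => xy.
rewrite -sqrtrM ?dot_ge0// (le_trans (ler_norm _))//.
by rewrite -sqrtr_sqr ler_sqrt// mulr_ge0 ?dot_ge0.
Qed.

Lemma dot_triangle x y : Num.sqrt (f (x + y) (x + y)) <=
  Num.sqrt (f x x) + Num.sqrt (f y y).
Proof.
have p : 0 <= Num.sqrt (f x x) + Num.sqrt (f y y) by rewrite addr_ge0 ?sqrtr_ge0.
rewrite -[leRHS]ger0_norm// -sqrtr_sqr ler_sqrt ?sqr_ge0//.
rewrite dotDD sqrrD !sqr_sqrtr ?dot_ge0//.
by rewrite lerD2r lerD2l mulr2n mulrDl mul1r lerD// dot_cauchy_schwarz.
Qed.

End dot_theory.

HB.factory Record Lmodule_isHilbert (R : realType) H & GRing.Lmodule R H := {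
  inner : {dot H for (@idfun R)};
  inner_complete : forall u : nat -> H,
    (forall e, 0 < e -> exists N, forall m n, (N <= m)%N -> (N <= n)%N ->
      inner (u m - u n) (u m - u n) < e) ->
    exists l, forall e, 0 < e -> exists N, forall n, (N <= n)%N ->
      inner (u n - l) (u n - l) < e
}.

HB.builders Context R H & Lmodule_isHilbert R H.

Let norm (x : H) : R := Num.sqrt (inner x x).

Let norm_triangle x y : norm (x + y) <= norm x + norm y.
Proof. exact: dot_triangle. Qed.

Let normZ (a : R) x : norm (a *: x) = `|a| * norm x.
Proof. by rewrite /norm dotZZ sqrtrM ?sqr_ge0// sqrtr_sqr. Qed.

Let norm_eq0 x : norm x = 0 -> x = 0.
Proof.
move=> /eqP; rewrite sqrtr_eq0 => x0; apply: (@dot_eq0 _ _ inner).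
by apply/eqP; rewrite eq_le x0 dot_ge0.
Qed.

HB.instance Definition _ :=
  Lmodule_isNormed.Build R H norm_triangle normZ norm_eq0.

Let inner_norm (x : H) : inner x x = `|x| ^+ 2.
Proof. by rewrite sqr_sqrtr// dot_ge0. Qed.

Let norm_lt (x : H) (e : R) : 0 < e -> (`|x| < e) = (inner x x < e ^+ 2).
Proof. by move=> /ltW e0; rewrite inner_norm ltr_pXn2r// ?nnegrE. Qed.

Let complete (F : set_system H) : ProperFilter F -> cauchy F -> cvg F.
Proof.
move=> PF /cauchyP cF.
have /choice[u uF] : forall n : nat, exists x : H, F (ball x (n.+1%:R^-1 : R)).
  by move=> n; apply: cF; rewrite invr_gt0.
have inv_lt (e : R) : 0 < e -> exists N : nat, forall n, (N <= n)%N ->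
    n.+1%:R^-1 < e.
  move=> e0; have [N _ HN] := near_infty_natSinv_lt (PosNum e0).
  by exists N => n Nn; exact: HN.
have cu : forall e, 0 < e -> exists N, forall m n, (N <= m)%N -> (N <= n)%N ->
    inner (u m - u n) (u m - u n) < e.
  move=> e e0; have e0' : 0 < Num.sqrt e by rewrite sqrtr_gt0.
  have [N HN] := inv_lt (Num.sqrt e / 2) (divr_gt0 e0' (ltr0n R 2)).
  exists N => m n Nm Nn; rewrite -[ltRHS]sqr_sqrtr ?ltW// -norm_lt//.
  have [z [zm zn]] := filter_ex (filterI (uF m) (uF n)).
  move: zm zn; rewrite -!ball_normE/= => zm zn.
  have -> : u m - u n = (u m - z) - (u n - z) by rewrite opprB addrA subrK.
  rewrite (le_lt_trans (ler_normB _ _))// (splitr (Num.sqrt e)) ltrD//.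
    exact: lt_trans zm (HN _ Nm).
  exact: lt_trans zn (HN _ Nn).
have [l lu] := inner_complete cu.
apply/cvg_ex; exists l; apply/cvgrPdist_lt => e e0.
have e20 : 0 < e / 2 by rewrite divr_gt0.
have [N1 HN1] := inv_lt _ e20.
have [N2 HN2] := lu _ (exprn_gt0 2 e20).
pose n := maxn N1 N2.
apply: filterS (uF n) => z; rewrite -ball_normE/= => zn.
have -> : l - z = - (u n - l) + (u n - z) by rewrite opprB addrA subrK.
rewrite (le_lt_trans (ler_normD _ _))// normrN (splitr e) ltrD//.
  by rewrite norm_lt//; apply: HN2; exact: leq_maxr.
by apply: lt_trans zn (HN1 _ _); exact: leq_maxl.
Qed.

HB.instance Definition _ := Uniform_isComplete.Build H complete.

HB.instance Definition _ :=
  CompleteNormedModule_isHilbert.Build R H inner_norm.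

HB.end.

Section square_summable.
Context {R : realType}.
Implicit Types u v : nat -> R.

Definition square_summable : {pred nat -> R} :=
  fun u => `[< cvgn (series (fun k => u k ^+ 2)) >].

Lemma square_summableP u :
  reflect (cvgn (series (fun k => u k ^+ 2))) (u \in square_summable).
Proof. exact: asboolP. Qed.

Lemma square_summable_le u v : v \in square_summable ->
  (forall k, `|u k| <= `|v k|) -> u \in square_summable.
Proof.
move=> /square_summableP cv uv; apply/square_summableP.
apply: series_le_cvg cv => k; rewrite ?sqr_ge0//.
by rewrite -[leLHS]real_normK ?num_real// -[leRHS]real_normK ?num_real// lerXn2r ?nnegrE.
Qed.

Lemma square_summable_bounded u (M : R) :
  (forall n, series (fun k => u k ^+ 2) n <= M) -> u \in square_summable.
Proof.
move=> uM; apply/square_summableP; apply: nondecreasing_is_cvgn.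
  by apply: nondecreasing_series => k _ _; exact: sqr_ge0.
by exists M => _ [n _ <-].
Qed.

Lemma square_summable_submod : submod_closed square_summable.
Proof.
split=> [|a u v /square_summableP cu /square_summableP cv].
  apply: (@square_summable_bounded _ 0) => n.
  by rewrite /series/= big1// => k _; rewrite expr0n.
apply/square_summableP.
apply: (@series_le_cvg _ _ (fun k => 2 * a ^+ 2 * u k ^+ 2 + 2 * v k ^+ 2)) => [k|k|k|].
- exact: sqr_ge0.
- by have := sqr_ge0 (a * u k); have := sqr_ge0 (v k); rewrite exprMn; lra.
- change ((a * u k + v k) ^+ 2 <= 2 * a ^+ 2 * u k ^+ 2 + 2 * v k ^+ 2).
  by have := sqr_ge0 (a * u k - v k); rewrite sqrrB sqrrD exprMn; lra.
- by apply: is_cvg_seriesD; [apply: (is_cvg_seriesZ cu)|apply: (is_cvg_seriesZ cv)].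
Qed.

HB.instance Definition _ := GRing.isSubmodClosed.Build R (nat -> R)
  square_summable square_summable_submod.

Record l2 := L2 { l2_seq :> nat -> R ; l2_seqP : l2_seq \in square_summable }.

HB.instance Definition _ := [isSub for l2_seq].
HB.instance Definition _ := [Choice of l2 by <:].
HB.instance Definition _ := [SubChoice_isSubLmodule of l2 by <:].

End square_summable.
Arguments l2 R : clear implicits.

Section l2_dot.
Context {R : realType}.
Implicit Types c d : l2 R.

Definition l2_dot c d : R := limn (series (fun k => c k * d k)).

Lemma l2P c d : (forall k, c k = d k) -> c = d.
Proof. by move=> cd; apply/val_inj/funext. Qed.

Lemma l2DE c d k : (c + d) k = c k + d k. Proof. by []. Qed.
Lemma l2NE c k : (- c) k = - c k. Proof. by []. Qed.
Lemma l2ZE (a : R) c k : (a *: c) k = a * c k. Proof. by []. Qed.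
Lemma l2_0E k : (0 : l2 R) k = 0. Proof. by []. Qed.

Lemma l2_sqr_cvg c : cvgn (series (fun k => c k ^+ 2)).
Proof. exact/square_summableP/l2_seqP. Qed.

Lemma l2_dot_cvg c d : cvgn (series (fun k => c k * d k)).
Proof.
apply: normed_cvg.
apply: (@series_le_cvg _ _ (fun k => c k ^+ 2 + d k ^+ 2)) => [k|k|k|] //=.
- by rewrite addr_ge0// sqr_ge0.
- rewrite normrM -[c k ^+ 2]real_normK ?num_real//.
  rewrite -[d k ^+ 2]real_normK ?num_real//.
  have := sqr_ge0 (`|c k| - `|d k|); have := normr_ge0 (c k).
  have := normr_ge0 (d k); nra.
- exact: (is_cvg_seriesD (@l2_sqr_cvg c) (@l2_sqr_cvg d)).
Qed.

Let dotC c d : l2_dot c d = l2_dot d c.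
Proof. by congr (limn (series _)); apply/funext => k; rewrite mulrC. Qed.

Let dot_linear c a d e : l2_dot c (a *: d + e) = a * l2_dot c d + l2_dot c e.
Proof.
rewrite /l2_dot (_ : (fun _ => _) =
  a *: (fun k => c k * d k) + (fun k => c k * e k)); last first.
  by apply/funext => k; rewrite /= mulrDr mulrCA.
rewrite lim_seriesD; first by rewrite lim_seriesZ//; exact: l2_dot_cvg.
  by apply: is_cvg_seriesZ; exact: l2_dot_cvg.
exact: l2_dot_cvg.
Qed.

Let dot_bilinear : bilinear_for *%R (@idfun R \; *%R) l2_dot.
Proof.
split=> [d a c c'|c a d d'] /=; last exact: dot_linear.
by rewrite !(dotC _ d) dot_linear.
Qed.

HB.instance Definition _ :=
  bilinear_isBilinear.Build R (l2 R) (l2 R) R _ _ l2_dot dot_bilinear.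

Let dot_hermitian c d : l2_dot c d = (-1) ^+ false * idfun (l2_dot d c).
Proof. by rewrite mul1r; exact: dotC. Qed.

HB.instance Definition _ :=
  isHermitianSesquilinear.Build R (l2 R) false idfun l2_dot dot_hermitian.

Lemma l2_dot_sum_ge c n : series (fun k => c k ^+ 2) n <= l2_dot c c.
Proof.
apply: nondecreasing_cvgn_le; last exact: l2_dot_cvg.
by apply: nondecreasing_series => k _ _; exact: sqr_ge0.
Qed.

Lemma l2_dot_ge_coord c k : c k ^+ 2 <= l2_dot c c.
Proof.
apply: le_trans (l2_dot_sum_ge c k.+1).
by rewrite /series/= big_nat_recr//= lerDr sumr_ge0// => i _; exact: sqr_ge0.
Qed.

Let dot_gt0 c : c != 0 -> 0 < l2_dot c c.
Proof.
move=> c0; rewrite ltNge; apply: contra c0 => cc; apply/eqP/l2P => k.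
apply/eqP; rewrite -sqrf_eq0 eq_le sqr_ge0 andbT.
exact: le_trans (l2_dot_ge_coord c k) cc.
Qed.

HB.instance Definition _ := isDotProduct.Build R (l2 R) l2_dot dot_gt0.

Let dot_complete (u : nat -> l2 R) :
    (forall e, 0 < e -> exists N, forall m n, (N <= m)%N -> (N <= n)%N ->
      l2_dot (u m - u n) (u m - u n) < e) ->
  exists l, forall e, 0 < e -> exists N, forall n, (N <= n)%N ->
    l2_dot (u n - l) (u n - l) < e.
Proof.
move=> cu.
have ck k : cvgn (fun n => u n k).
  apply/cauchy_cvgP/cauchy_exP => e e0.
  have [N HN] := cu _ (exprn_gt0 2 e0).
  exists (u N k); exists N => //= n Nn; rewrite -ball_normE/=.
  rewrite -(@ltr_pXn2r _ 2%N)// ?nnegrE ?(ltW e0)// real_normK ?num_real//.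
  exact: le_lt_trans (l2_dot_ge_coord (u N - u n) k) (HN _ _ _ _).
pose l k := limn (fun n => u n k).
have key e N : (forall m n, (N <= m)%N -> (N <= n)%N ->
      l2_dot (u m - u n) (u m - u n) < e) ->
    forall n K, (N <= n)%N -> series (fun k => (u n k - l k) ^+ 2) K <= e.
  move=> HN n K Nn.
  have : series (fun k => (u n k - u m k) ^+ 2) K @[m --> \oo] -->
         series (fun k => (u n k - l k) ^+ 2) K.
    apply: cvg_big => [|k _]; first exact: add_continuous.
    have ukl : u n k - u m k @[m --> \oo] --> u n k - l k.
      by apply: cvgB; [exact: cvg_cst|exact: ck].
    exact: (cvgM ukl ukl).
  move=> h; apply: (cvgr_to_le h); near=> m.
  apply: le_trans (ltW (HN n m Nn _)); last by near: m; exists N.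
  exact: (l2_dot_sum_ge (u n - u m)).
have ul : l \in square_summable.
  have [N HN] := cu 1 ltr01.
  have dl : (fun k => u N k - l k) \in square_summable.
    by apply: (@square_summable_bounded _ _ 1) => K; exact: (key _ N).
  have -> : l = (u N : nat -> R) - (fun k => u N k - l k).
    by apply/funext => k; rewrite /= opprB addrC subrK.
  by apply: rpredB => //; exact: l2_seqP.
exists (L2 ul) => e e0.
have [N HN] := cu _ (divr_gt0 e0 (ltr0n R 2)).
exists N => n Nn; apply: (@le_lt_trans _ _ (e / 2)).
  apply: limr_le; first exact: l2_dot_cvg.
  by apply: nearW => K; exact: (key _ N).
by rewrite ltr_pdivrMr// ltr_pMr// ltr1n.
Unshelve. all: by end_near. Qed.

HB.instance Definition _ :=
  @Lmodule_isHilbert.Build R (l2 R) l2_dot dot_complete.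

Lemma l2_innerE c d : inner c d = limn (series (fun k => c k * d k)).
Proof. by []. Qed.

Lemma l2_normE c : `|c| = Num.sqrt (limn (series (fun k => c k ^+ 2))).
Proof. by []. Qed.

End l2_dot.

Section operators.
Context {R : realType} {X Y : hilbertType R}.
Implicit Types (T : X -> Y) (K : set X).

Definition opnorm T : R := sup [set `|T x| | x in [set x | `|x| <= 1]].

Definition null_space T : set X := [set x | T x = 0].

(* xget 0 A is an element of A, or 0 if A is empty; the sets below are
   singletons in the intended uses (T bounded linear, K closed subspace). *)
Definition adjoint T (c : Y) : X :=
  xget 0 [set x | forall y, inner (T y) c = inner y x].

(* For bounded linear T with closed range the intersection is a singleton for
   every c, and mp_inverse T c is its element. *)
Definition mp_inverse T (c : Y) : X :=
  xget 0 ([set x | adjoint T (T x) = adjoint T c] `&` range (adjoint T)).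

Definition orth_proj K (x : X) : X :=
  xget 0 [set y | K y /\ forall z, K z -> inner (x - y) z = 0].

End operators.

Definition separable (X : topologicalType) :=
  exists2 D : set X, countable D & dense D.

Section frames.
Context {R : realType} {H : hilbertType R}.

Definition is_frame (x : nat -> H) := exists A B : R, [/\ 0 < A, A <= B &
  forall y : H,
    ((A * `|y| ^+ 2)%:E <= \sum_(0 <= k <oo) (`|inner y (x k)| ^+ 2)%:E)%E /\
    (\sum_(0 <= k <oo) (`|inner y (x k)| ^+ 2)%:E <= (B * `|y| ^+ 2)%:E)%E].

End frames.

Record analysis_operator (R : realType) (H : hilbertType R) :=
  AnalysisOperator {
    analysis_fun :> H -> l2 R ;
    analysis_frame : exists2 x : nat -> H, is_frame x &
      forall y k, analysis_fun y k = inner y (x k)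
  }.

Section analysis_operator_theory.
Context {R : realType} {H : hilbertType R} (T : analysis_operator H).
Implicit Types y z : H.

Lemma analysis_linear a y z : T (a *: y + z) = a *: T y + T z.
Proof.
have [x _ Tx] := analysis_frame T; apply: l2P => k.
rewrite l2DE l2ZE !Tx -![inner _ (x k)](dotC _ (x k)).
by rewrite dotDr dotZr.
Qed.

Lemma analysisB y z : T (y - z) = T y - T z.
Proof. by rewrite addrC -scaleN1r analysis_linear scaleN1r addrC. Qed.

Lemma analysisZ a y : T (a *: y) = a *: T y.
Proof.
have T0 : T 0 = 0 by rewrite -(subrr 0) analysisB subrr.
by rewrite -[a *: y]addr0 analysis_linear T0 addr0.
Qed.

Lemma analysis_bounds : exists A B : R, [/\ 0 < A, 0 < B & forall y,
  A * `|y| ^+ 2 <= `|T y| ^+ 2 /\ `|T y| ^+ 2 <= B * `|y| ^+ 2].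
Proof.
have [x [A [B [A0 AB xAB]]] Tx] := analysis_frame T.
exists A, B; split => // [|y]; first exact: lt_le_trans AB.
have -> : `|T y| ^+ 2 = limn (series (fun k => T y k ^+ 2)).
  by rewrite -inner_normE l2_innerE.
have [] := xAB y.
have -> : (\sum_(0 <= k <oo) (`|inner y (x k)| ^+ 2)%:E)%E =
    (limn (series (fun k => T y k ^+ 2)))%:E.
  rewrite -EFin_lim; last exact: l2_sqr_cvg.
  congr (limn _); apply/funext => n; rewrite /= /series/= -sumEFin.
  by apply: eq_bigr => k _; rewrite Tx real_normK ?num_real.
by rewrite !lee_fin.
Qed.

Lemma analysis_inj y : T y = 0 -> y = 0.
Proof.
have [A [B [A0 _ /(_ y)[+ _]]]] := analysis_bounds.
move=> + Ty0; rewrite Ty0 normr0 expr0n/= pmulr_rle0// => y0.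
by apply/eqP; rewrite -normr_eq0 -sqrf_eq0 eq_le y0 sqr_ge0.
Qed.

Lemma analysis_opnorm_gt0 y : T y != 0 -> 0 < opnorm T.
Proof.
have [A [B [_ B0 TB]]] := analysis_bounds.
have [->|y0 Ty] := eqVneq y 0.
  by rewrite -(scale0r 0) analysisZ scale0r eqxx.
apply: (@lt_le_trans _ _ `|T (`|y|^-1 *: y)|).
  by rewrite analysisZ normr_gt0 scaler_eq0 invr_eq0 normr_eq0 negb_or y0.
apply: sup_upper_bound; last first.
  by exists (`|y|^-1 *: y) => //=; rewrite normfZV.
split; first by exists `|T 0|; exists 0 => //=; rewrite normr0 ler01.
exists (Num.sqrt B) => _ [z /= z1 <-].
rewrite -[leLHS]ger0_norm// -sqrtr_sqr ler_wsqrtr//.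
have [_ /le_trans->//] := TB z.
by rewrite ler_piMr ?(ltW B0)// expr_le1.
Qed.

Lemma orth_proj_analysis y : orth_proj (null_space T) y = 0.
Proof. by rewrite /orth_proj; case: xgetP => // z _ [/analysis_inj]. Qed.

End analysis_operator_theory.

(* The space H_T: the vector space H with the inner product renormed_dot; its
   norm is spelled out in renormed_normE. *)
Definition renormed (R : realType) (H : hilbertType R)
  (T : analysis_operator H) : Type := H.

Section renormed_hilbert.
Context {R : realType} {H : hilbertType R} (T : analysis_operator H).
Local Notation HT := (renormed T).

HB.instance Definition _ := GRing.Lmodule.copy HT H.

Definition renormed_dot (y z : HT) : R :=
  inner (T y) (T z) / opnorm T ^+ 2 +
  inner (y : H) (orth_proj (null_space T) z).

Let dotE y z : renormed_dot y z = inner (T y) (T z) / opnorm T ^+ 2.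
Proof. by rewrite /renormed_dot orth_proj_analysis dot0r addr0. Qed.

Let dotC y z : renormed_dot y z = renormed_dot z y.
Proof. by rewrite !dotE dotC. Qed.

Let dot_linear x a y z :
  renormed_dot x (a *: y + z) = a * renormed_dot x y + renormed_dot x z.
Proof. by rewrite !dotE analysis_linear dotDr dotZr mulrDl mulrA. Qed.

Let dot_bilinear : bilinear_for *%R (@idfun R \; *%R) renormed_dot.
Proof.
split=> [z a x y|x a y z] /=; last exact: dot_linear.
by rewrite !(dotC _ z) dot_linear.
Qed.

HB.instance Definition _ :=
  bilinear_isBilinear.Build R HT HT R _ _ renormed_dot dot_bilinear.

Let dot_hermitian x y :
  renormed_dot x y = (-1) ^+ false * idfun (renormed_dot y x).
Proof. by rewrite mul1r; exact: dotC. Qed.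

HB.instance Definition _ :=
  isHermitianSesquilinear.Build R HT false idfun renormed_dot dot_hermitian.

Let dot_gt0 x : x != 0 -> 0 < renormed_dot x x.
Proof.
move=> x0; have Tx : T x != 0 by apply: contra x0 => /eqP/analysis_inj/eqP.
by rewrite dotE divr_gt0 ?neq0_dnorm_gt0 ?exprn_gt0// (analysis_opnorm_gt0 Tx).
Qed.

HB.instance Definition _ := isDotProduct.Build R HT renormed_dot dot_gt0.

Let dot_equiv : exists2 C : R, 0 < C & forall x : HT,
  `|x : H| ^+ 2 <= C * renormed_dot x x /\ renormed_dot x x <= C * `|x : H| ^+ 2.
Proof.
have [A [B [A0 B0 TAB]]] := analysis_bounds T.
set s := opnorm T ^+ 2.
have s0 : 0 <= s by exact: sqr_ge0.
have C1 : 0 <= s / A by rewrite divr_ge0// ltW.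
have C2 : 0 <= B / s by rewrite divr_ge0// ltW.
exists (s / A + B / s + 1) => [|x].
  by rewrite ltr_pwDr// addr_ge0.
have [x0|x0] := eqVneq (x : H) 0.
  have T0 : T x = 0.
    by rewrite x0 -(scale0r (0 : H)) analysisZ scale0r.
  by rewrite dotE T0 dot0r mul0r x0 normr0 expr0n/= !mulr0.
have Tx : T x != 0 by apply: contra x0 => /eqP/analysis_inj/eqP.
have sp : 0 < s by rewrite exprn_gt0// (analysis_opnorm_gt0 Tx).
have [TA TB] := TAB x.
rewrite dotE inner_normE -/s; split.
  apply: (@le_trans _ _ (s / A * (`|T x| ^+ 2 / s))).
    have -> : s / A * (`|T x| ^+ 2 / s) = `|T x| ^+ 2 / A.
      by field; rewrite !gt_eqF.
    by rewrite ler_pdivlMr// mulrC.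
  rewrite ler_wpM2r ?divr_ge0 ?sqr_ge0//; lra.
apply: (@le_trans _ _ (B / s * `|x : H| ^+ 2)).
  by rewrite [leRHS]mulrAC ler_wpM2r ?invr_ge0.
rewrite ler_wpM2r ?sqr_ge0//; lra.
Qed.

Let dot_complete (u : nat -> HT) :
    (forall e, 0 < e -> exists N, forall m n, (N <= m)%N -> (N <= n)%N ->
      renormed_dot (u m - u n) (u m - u n) < e) ->
  exists l, forall e, 0 < e -> exists N, forall n, (N <= n)%N ->
    renormed_dot (u n - l) (u n - l) < e.
Proof.
have [C C0 HC] := dot_equiv.
move=> cu; have /cvg_ex[l ul] : cvgn (u : nat -> H).
  apply/cauchy_cvgP/cauchy_exP => e e0.
  have [N HN] := cu _ (divr_gt0 (exprn_gt0 2 e0) C0).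
  exists (u N : H); exists N => //= n Nn; rewrite -ball_normE/=.
  rewrite -(@ltr_pXn2r _ 2%N)// ?nnegrE ?(ltW e0)//.
  apply: le_lt_trans (HC (u N - u n)).1 _.
  by rewrite mulrC -ltr_pdivlMr//; exact: HN.
exists l => e e0.
have e'0 : 0 < Num.sqrt (e / C) by rewrite sqrtr_gt0 divr_gt0.
move/cvgrPdist_lt : ul => /(_ _ e'0)[N _ HN].
exists N => n Nn; apply: le_lt_trans (HC (u n - l)).2 _.
rewrite mulrC -ltr_pdivlMr// -[ltRHS]sqr_sqrtr; last by rewrite divr_ge0// ltW.
rewrite ltr_pXn2r// ?nnegrE ?sqrtr_ge0// distrC.
exact: HN.
Qed.

HB.instance Definition _ :=
  @Lmodule_isHilbert.Build R HT renormed_dot dot_complete.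

Lemma renormed_normE (x : HT) : `|x| = Num.sqrt
  (`|T x| ^+ 2 / opnorm T ^+ 2 + `|orth_proj (null_space T) x : H| ^+ 2).
Proof.
rewrite [LHS]/(Num.sqrt (renormed_dot x x)) dotE orth_proj_analysis.
by rewrite normr0 expr0n/= addr0 inner_normE.
Qed.

End renormed_hilbert.

Section convex_analysis.
Context {R : realType} {X : hilbertType R}.
Implicit Types (f g h : X -> \bar R) (P : X -> X).
Local Open Scope ereal_scope.

Definition proper_fun f :=
  (forall x, -oo < f x) /\ (exists x, f x < +oo).

Definition econvex f := forall (x y : X) (t : R), (0 < t)%R -> (t < 1)%R ->
  f (t *: x + (1 - t) *: y)%R <= t%:E * f x + (1 - t)%:E * f y.

Definition Gamma0 : set (X -> \bar R) :=
  [set f | [/\ proper_fun f, econvex f & lower_semicontinuous f]].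

Definition argmin f : set X := [set x | forall y, f x <= f y].

Definition is_proximity_operator P := exists2 h, Gamma0 h & forall x : X,
  argmin (fun y => (2^-1 * `|x - y| ^+ 2)%:E + h y) = [set P x].

Definition infconv g h (z : X) : \bar R :=
  ereal_inf (range (fun w => g w + h (z - w)%R)).

Definition indicator (S : set X) (x : X) : \bar R :=
  if `[< S x >] then 0 else +oo.

End convex_analysis.

Section soft_shrinkage.
Context {R : realType}.

Definition soft (lam t : R) : R :=
  if lam < t then t - lam else if t < - lam then t + lam else 0.

(* The default value 0 of insubd is never used for lam >= 0, see soft_l2E. *)
Definition soft_l2 (lam : R) (c : l2 R) : l2 R :=
  insubd 0 (fun k => soft lam (c k)).

Lemma soft_l2E (lam : R) (c : l2 R) k : 0 <= lam ->
  soft_l2 lam c k = soft lam (c k).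
Proof.
move=> lam0; rewrite /soft_l2 -[l2_seq _]/(val _) insubdK//.
apply: square_summable_le (l2_seqP c) _ => i.
rewrite /soft; case: ltP => [h|h].
  by rewrite !ger0_norm; lra.
case: ltP => [h'|h']; last by rewrite normr0.
by rewrite !ler0_norm; lra.
Qed.

Definition l1_norm (c : l2 R) : \bar R := (\sum_(0 <= k <oo) `|c k|%:E)%E.

End soft_shrinkage.

(* Main.v *)
Require Import Defs.
From mathcomp Require Import all_boot all_order all_algebra.
From mathcomp Require Import ring lra.
From mathcomp Require Import all_classical all_reals.
From mathcomp Require Import ereal topology normedtype sequences.

Set Implicit Arguments.
Unset Strict Implicit.
Unset Printing Implicit Defensive.
Import Order.TTheory GRing.Theory Num.Theory.
Import numFieldNormedType.Exports.
Local Open Scope classical_set_scope.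
Local Open Scope ring_scope.

(** Write V for the range of T, P_V for the orthogonal projection onto it, and
    s for the squared operator norm of T.  On H_T the inner product is
    <x, y> = <T x, T y> / s, so T is, up to the factor s, an isometry onto V,
    and u = T^+ p is characterised by T u = P_V p, that is, by T u - p being
    orthogonal to V ([mp_inverseP]).

    Everything about a proximity operator that is used here is the subgradient
    inequality h(p_x) + <x - p_x, w - p_x> <= h(w) at p_x = Prox x
    ([argmin_subgradient]).  Conversely, a map P is a proximity operator as soon
    as some real function phi satisfies
      phi(x) + <x - P x, P z - P x> <= phi(z) for all x and z,
    because the supremum over x of the affine functions
    y |-> phi(x) + <x - P x, y - P x> is then a function in Gamma0 whose
    proximity operator is P ([proximity_operator_of_subgradients]).  For
    P x = T^+ Prox (T x), with p_x = Prox (T x) and a_x = T (P x) - p_x, the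
    function phi(x) = (h(p_x) + |a_x|^2 / 2) / s works, since every a_x is
    orthogonal to V.  Lower semi-continuity thus comes from a supremum of
    continuous functions, and not from the infimal convolution.

    For the explicit formula, let p be a point at which a function g satisfies
    the subgradient inequality with direction T x - p, and let u = T^+ p.
    Pythagoras' theorem rewrites the objective at y as the infimum of
    (g(w) + |T x - w|^2 / 2) / s over all w with P_V w = T y.  The subgradient
    inequality makes g(w) + |T x - w|^2 / 2 exceed its value at p by at least
    |w - p|^2 / 2, which is at least |T y - T u|^2 / 2.  The objective at y thus
    exceeds its value at u by at least |T y - T u|^2 / (2 s), and injectivity
    of T makes u the only minimiser ([argmin_infconv_pullback]).  Soft shrinkage
    satisfies the subgradient inequality for the l1 norm coordinate by
    coordinate ([soft_l1_subgradient]). *)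

(** * Inner products and the Riesz representation theorem *)

Section inner_theory.
Context {R : realType} {X : hilbertType R}.
Implicit Types x y z : X.

Lemma innerDl x y z : inner (x + y) z = inner x z + inner y z.
Proof. by rewrite dotC dotDr !(dotC _ z). Qed.

Lemma innerNl x y : inner (- x) y = - inner x y.
Proof. by rewrite -scaleN1r dotC dotZr mulN1r dotC. Qed.

Lemma innerNr x y : inner x (- y) = - inner x y.
Proof. by rewrite dotC innerNl dotC. Qed.

Lemma innerBl x y z : inner (x - y) z = inner x z - inner y z.
Proof. by rewrite innerDl innerNl. Qed.

Lemma innerBr x y z : inner x (y - z) = inner x y - inner x z.
Proof. by rewrite dotDr innerNr. Qed.

Lemma innerZl a x y : inner (a *: x) y = a * inner x y.
Proof. by rewrite dotC dotZr dotC. Qed.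

Lemma norm_sqrD x y : `|x + y| ^+ 2 = `|x| ^+ 2 + 2 * inner x y + `|y| ^+ 2.
Proof. by rewrite -!inner_normE dotDD. Qed.

Lemma norm_sqrB x y : `|x - y| ^+ 2 = `|x| ^+ 2 - 2 * inner x y + `|y| ^+ 2.
Proof. by rewrite norm_sqrD normrN innerNr mulrN. Qed.

Lemma inner_le_norm x y : `|inner x y| <= `|x| * `|y|.
Proof.
have H a b : inner a b <= `|a| * `|b| :> R.
  rewrite -[`|a|]ger0_norm// -[`|b|]ger0_norm// -!sqrtr_sqr -!inner_normE.
  exact: dot_cauchy_schwarz.
by rewrite ler_norml H andbT lerNl -innerNl -(normrN x) H.
Qed.

Lemma inner_ext x y : (forall z, inner x z = inner y z) -> x = y.
Proof.
move=> xy; apply/eqP; rewrite -subr_eq0 -normr_eq0 -sqrf_eq0 -inner_normE.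
by rewrite innerBl xy subrr.
Qed.

Lemma pythagoras x y z : inner (x - y) (y - z) = 0 ->
  `|x - z| ^+ 2 = `|x - y| ^+ 2 + `|y - z| ^+ 2.
Proof.
move=> xyz; rewrite -[x - z](subrKA y) (norm_sqrD (x - y) (y - z)).
by rewrite xyz mulr0 addr0.
Qed.

(** Here u and v play the projections of p and r onto a subspace containing x:
    the subgradient inequality at p with direction x - p survives projection
    once half the squared distance to the subspace is added to the values.
    Orthogonality turns <x - u, v - u> into
    <x - p, r - p> + <u - p, v - r> - |u - p|^2, and
    <u - p, v - r> <= (|u - p|^2 + |v - r|^2) / 2. *)
Lemma subgradient_proj (x u v p r : X) (a b : R) :
  inner (u - p) (x - u) = 0 -> inner (u - p) (v - u) = 0 ->
  inner (v - r) (x - u) = 0 ->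
  a + inner (x - p) (r - p) <= b ->
  a + 2^-1 * `|u - p| ^+ 2 + inner (x - u) (v - u) <= b + 2^-1 * `|v - r| ^+ 2.
Proof.
move=> up_xu up_vu vr_xu ab.
have vu : v - u = (r - p) + ((v - r) - (u - p)).
  by rewrite opprB addrCA !subrKA.
have up_rp : inner (u - p) (r - p) = `|u - p| ^+ 2 - inner (u - p) (v - r).
  by move: up_vu; rewrite {1}vu dotDr (innerBr _ (v - r)) inner_normE; lra.
have -> : inner (x - u) (v - u) =
    inner (x - p) (r - p) + inner (u - p) (v - r) - `|u - p| ^+ 2.
  have xu : x - u = (x - p) - (u - p) by rewrite opprB addrA subrK.
  rewrite {1}vu dotDr [inner _ (_ - (u - p))]dotC
    (innerBl (v - r)) vr_xu up_xu.
  by rewrite {1}xu (innerBl (x - p)) up_rp; lra.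
have := sqr_ge0 `|(u - p) - (v - r)|; rewrite (norm_sqrB (u - p)); lra.
Qed.

(** Here u and y play the projections of p and w onto a subspace containing x.
    Up to the term |x - y|^2 / 2, the right-hand side is
    a + |x - p|^2 / 2 + |w - p|^2 / 2, and projecting w - p onto the subspace
    gives y - u, whose norm is not larger. *)
Lemma proj_growth (x y u p w : X) (a : R) :
  inner (x - y) (y - w) = 0 -> inner (y - u) (y - w) = 0 ->
  inner (y - u) (u - p) = 0 ->
  a + 2^-1 * `|x - p| ^+ 2 + 2^-1 * `|y - u| ^+ 2 - 2^-1 * `|x - y| ^+ 2 <=
  a + inner (x - p) (w - p) + 2^-1 * `|y - w| ^+ 2.
Proof.
move=> xy_yw yu_yw yu_up.
have wp : `|w - p| ^+ 2 = `|y - u| ^+ 2 + `|(u - p) - (y - w)| ^+ 2.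
  have -> : w - p = (y - u) + ((u - p) - (y - w)).
    by rewrite opprB addrA subrKA addrC subrKA.
  by rewrite norm_sqrD innerBr yu_up yu_yw subrr mulr0 addr0.
have xw := pythagoras xy_yw.
have xpw : `|x - w| ^+ 2 = `|x - p| ^+ 2 - 2 * inner (x - p) (w - p)
    + `|w - p| ^+ 2.
  by rewrite -norm_sqrB opprB addrA subrK.
have := sqr_ge0 `|(u - p) - (y - w)|; lra.
Qed.

End inner_theory.

Section riesz.
Context {R : realType} {X : hilbertType R}.

(** The representing vector minimises y |-> |y|^2 - 2 l(y): minimising sequences
    are Cauchy by the parallelogram law, and the first-order condition at the
    limit is the claim. *)
Theorem riesz_representation (l : X -> R) (C : R) :
  (forall a y z, l (a *: y + z) = a * l y + l z) ->
  (forall y, `|l y| <= C * `|y|) ->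
  exists x, forall y, inner x y = l y.
Proof.
move=> ll lC.
have l0 : l 0 = 0.
  by have := ll (-1) 0 0; rewrite scaleN1r mulN1r !addNr.
have lZ a y : l (a *: y) = a * l y by rewrite -[a *: y]addr0 ll l0 addr0.
have lD y z : l (y + z) = l y + l z by rewrite -[y]scale1r ll mul1r scale1r.
pose J y : R := `|y| ^+ 2 - 2 * l y.
have J_lb y : - C ^+ 2 <= J y.
  have := lC y; rewrite ler_norml => /andP[_].
  have := sqr_ge0 (`|y| - C); rewrite /J; nra.
pose m := inf (range J).
have Jinf : has_inf (range J).
  by split; [exists (J 0), 0|exists (- C ^+ 2) => _ [y _ <-]].
have mJ y : m <= J y by apply: ge_inf; [exact: Jinf.2|exists y].
have /choice[u uJ] (n : nat) : exists y, J y < m + n.+1%:R^-1.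
  have n0 : (0 : R) < n.+1%:R^-1 by rewrite invr_gt0.
  by have [_ [y _ <-] yJ] := inf_adherent n0 Jinf; exists y.
have inv_lt (e : R) : 0 < e -> exists N : nat, forall n, (N <= n)%N ->
    n.+1%:R^-1 < e.
  move=> e0; have [N _ HN] := near_infty_natSinv_lt (PosNum e0).
  by exists N => n Nn; exact: HN.
(* The parallelogram law bounds the distance of two almost minimisers. *)
have par y z : `|y - z| ^+ 2 <= 2 * (J y - m) + 2 * (J z - m).
  have := mJ (2^-1 *: (y + z)).
  rewrite /J lZ lD normrZ exprMn norm_sqrD norm_sqrB ger0_norm ?invr_ge0//.
  by rewrite exprVn; lra.
have /cvg_ex[x ux] : cvgn u.
  apply/cauchy_cvgP/cauchy_exP => e e0.
  have [N HN] := inv_lt (e ^+ 2 / 4) (divr_gt0 (exprn_gt0 2 e0) (ltr0n R 4)).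
  exists (u N); exists N => //= n Nn; rewrite -ball_normE/=.
  rewrite -(@ltr_pXn2r _ 2%N)// ?nnegrE ?(ltW e0)//.
  apply: le_lt_trans (par _ _) _.
  have := HN _ (leqnn N); have := HN _ Nn.
  have := uJ N; have := uJ n.
  move: (N.+1%:R^-1) (n.+1%:R^-1) => a b; move: (J _) (J _) => ? ?; lra.
exists x => y; apply/eqP; rewrite -subr_eq0 -normr_le0.
apply/ler_addgt0Pr => e e0; rewrite add0r.
have y1 : 0 < 2 * (`|y| + 1) by rewrite mulr_gt0// ltr_wpDl.
pose d : R := e / (2 * (`|y| + 1)).
have d0 : 0 < d by exact: divr_gt0.
move/cvgrPdist_lt : ux => /(_ _ d0)[N1 _ HN1].
have [N2 HN2] := inv_lt _ (exprn_gt0 2 d0).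
pose n := maxn N1 N2.
have un : `|x - u n| < d by apply: HN1; rewrite /= leq_maxl.
have en : n.+1%:R^-1 < d ^+ 2 by apply: HN2; rewrite leq_maxr.
(* The first-order condition holds at the almost minimiser u n up to the error
   d * |y|, by nonnegativity of a quadratic polynomial in t. *)
pose b := inner (u n) y - l y.
have Jt t : 0 <= t ^+ 2 * `|y| ^+ 2 + 2 * t * b + d ^+ 2.
  have := mJ (t *: y + u n); have := uJ n.
  rewrite /J ll norm_sqrD normrZ exprMn real_normK ?num_real// innerZl.
  move: en; move: (n.+1%:R^-1) => a; rewrite /b [inner y _]dotC; lra.
have bd : `|b| <= d * `|y|.
  have [y0|y0] := eqVneq y 0.
    by rewrite /b y0 l0 dot0r subrr !normr0 mulr0.
  have yp : 0 < `|y| by rewrite normr_gt0.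
  rewrite -(@ler_pXn2r _ 2%N) ?nnegrE//; last by rewrite mulr_ge0// ltW.
  rewrite real_normK ?num_real// exprMn.
  (* t = - b / |y|^2 minimises the quadratic polynomial. *)
  have := Jt (- b / `|y| ^+ 2).
  have -> : (- b / `|y| ^+ 2) ^+ 2 * `|y| ^+ 2 + 2 * (- b / `|y| ^+ 2) * b
    + d ^+ 2 = d ^+ 2 - b ^+ 2 / `|y| ^+ 2 by field; rewrite gt_eqF.
  by rewrite subr_ge0 ler_pdivrMr// exprn_gt0.
suff : `|inner (x - u n) y + b| <= e by rewrite innerBl /b addrA subrK.
have -> : e = d * (2 * (`|y| + 1)) by rewrite /d divfK// gt_eqF.
have := inner_le_norm (x - u n) y; have := ler_normD (inner (x - u n) y) b.
have := normr_ge0 y; nra.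
Qed.

End riesz.

(** * The adjoint and the Moore-Penrose inverse of an analysis operator *)

Section analysis_operator_pseudoinverse.
Context {R : realType} {H : hilbertType R} (T : analysis_operator H).
Local Notation HT := (renormed T).

Lemma analysis_bounded : exists C : R, forall y, `|T y| <= C * `|y|.
Proof.
have [A [B [_ B0 TB]]] := analysis_bounds T.
exists (Num.sqrt B) => y; have [_ TBy] := TB y.
have yB : 0 <= Num.sqrt B * `|y| by rewrite mulr_ge0// sqrtr_ge0.
rewrite -(@ler_pXn2r _ 2%N) ?nnegrE// exprMn.
by rewrite (sqr_sqrtr (ltW B0)).
Qed.

Lemma adjointP c y : inner (T y) c = inner y (adjoint T c).
Proof.
rewrite /adjoint; case: xgetP => [x _ /(_ y)//|nx].
have [C TC] := analysis_bounded.
have [||x lx] := @riesz_representation R H (fun y => inner (T y) c) (C * `|c|).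
- by move=> a v w; rewrite analysis_linear innerDl innerZl.
- move=> v; rewrite (le_trans (inner_le_norm _ _))// mulrAC.
  by rewrite ler_wpM2r.
by case: (nx x) => v; rewrite -lx dotC.
Qed.

Lemma renormed_innerE (x y : HT) :
  inner x y = inner (T x) (T y) / opnorm T ^+ 2.
Proof.
rewrite -[LHS]/(renormed_dot x y) /renormed_dot.
by rewrite orth_proj_analysis dot0r addr0.
Qed.

Lemma renormed_norm_sqr (x : HT) : `|x| ^+ 2 = `|T x| ^+ 2 / opnorm T ^+ 2.
Proof. by rewrite -inner_normE renormed_innerE inner_normE. Qed.

Hypothesis T_neq0 : exists x, T x != 0.

Lemma opnorm_sqr_gt0 : 0 < opnorm T ^+ 2.
Proof.
by have [x Tx] := T_neq0; rewrite exprn_gt0// (analysis_opnorm_gt0 Tx).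
Qed.

(** This is the Riesz theorem on H_T, where the form <T x, T y> is a multiple of
    the inner product; the lower frame bound makes y |-> <z, y> bounded for the
    norm of H_T. *)
Lemma frame_operator_surj (z : H) :
  exists x : H, forall y, inner (T x) (T y) = inner z y.
Proof.
have s0 := opnorm_sqr_gt0.
have [A [B [A0 _ TA]]] := analysis_bounds T.
have nA (y : HT) : `|y : H| <= Num.sqrt (opnorm T ^+ 2 / A) * `|y|.
  rewrite -(@ler_pXn2r _ 2%N) ?nnegrE// ?mulr_ge0 ?sqrtr_ge0//.
  rewrite exprMn renormed_norm_sqr (sqr_sqrtr (ltW (divr_gt0 s0 A0))).
  have -> : opnorm T ^+ 2 / A * (`|T y| ^+ 2 / opnorm T ^+ 2) = `|T y| ^+ 2 / A.
    by rewrite mulrC mulrA divfK ?gt_eqF.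
  by rewrite ler_pdivlMr// mulrC (TA y).1.
have [||x lx] := @riesz_representation R HT
    (fun y : HT => inner z (y : H) / opnorm T ^+ 2)
    (`|z| * Num.sqrt (opnorm T ^+ 2 / A) / opnorm T ^+ 2).
- by move=> a v w; rewrite dotDr dotZr mulrDl mulrA.
- move=> v; rewrite normrM [`|_^-1|]gtr0_norm ?invr_gt0// mulrAC.
  rewrite ler_wpM2r ?invr_ge0 ?(ltW s0)//.
  by rewrite (le_trans (inner_le_norm _ _))// -mulrA ler_wpM2l.
exists x => y; have := lx y; rewrite renormed_innerE.
by apply: mulIf; rewrite invr_eq0 gt_eqF.
Qed.

(** T^+ c is the preimage under T of the orthogonal projection of c onto the
    range of T.  The point is that the set defining T^+ c is nonempty: T^* T is
    surjective, so T^* T x = T^* c has a solution x, and T^* is surjective, so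
    this x lies in its range. *)
Lemma mp_inverseP c y : inner (T (mp_inverse T c) - c) (T y) = 0.
Proof.
rewrite /mp_inverse; case: xgetP => [x _ [/= xc _]|nx].
  by rewrite innerBl ![inner _ (T y)]dotC !adjointP xc subrr.
have [x Tx] := frame_operator_surj (adjoint T c).
have [v Tv] := frame_operator_surj x.
case: (nx x); split.
  by apply: inner_ext => w; rewrite -Tx dotC -adjointP dotC.
exists (T v) => //; apply: inner_ext => w.
by rewrite -Tv dotC -adjointP dotC.
Qed.

Lemma null_space_adjointP c :
  null_space (adjoint T) c <-> forall y, inner c (T y) = 0.
Proof.
split=> [/= c0 y|cT]; first by rewrite dotC adjointP c0 dot0r.
by apply: inner_ext => y; rewrite dotC -adjointP dotC cT dotC dot0r.
Qed.

End analysis_operator_pseudoinverse.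

(** * Proximity operators and subgradients *)

Section proximity.
Context {R : realType} {X : hilbertType R}.
Implicit Types (h : X -> \bar R) (P : X -> X).

(** Moving from the minimiser p towards w by a step t changes the quadratic term
    by - t <x - p, w - p> + t^2 |w - p|^2 / 2 and, by convexity, h by at most
    t (h w - h p); dividing by t and letting t tend to 0 gives the claim. *)
Lemma argmin_subgradient h (x p : X) : Gamma0 h ->
  argmin (fun y => (2^-1 * `|x - y| ^+ 2)%:E + h y)%E p ->
  h p \is a fin_num /\
  forall w, (h p + (inner (x - p) (w - p))%:E <= h w)%E.
Proof.
move=> [[h_ninfty [w0 hw0]] hconv _] pmin.
have hp : h p \is a fin_num.
  rewrite fin_numE gt_eqF//=; apply/negP => /eqP hpy.
  have := pmin w0; rewrite hpy addey// leye_eq => /eqP E.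
  have : ((2^-1 * `|x - w0| ^+ 2)%:E + h w0 < +oo)%E.
    by rewrite lte_add_pinfty ?ltry.
  by rewrite E ltxx.
split=> // w.
move: (hconv w p) (h_ninfty w) hp (pmin : forall y, _ <= _)%E.
case: (h w) => [r||]//; last by rewrite leey.
case: (h p) => // q pw _ _ {}pmin; rewrite -EFinD lee_fin.
have tle t : 0 < t -> t < 1 ->
    inner (x - p) (w - p) <= 2^-1 * t * `|w - p| ^+ 2 + (r - q).
  move=> t0 t1; have := pw t t0 t1; rewrite -!EFinM -EFinD => pwt.
  have := le_trans (pmin _) (leeD2l _ pwt). rewrite -!EFinD lee_fin.
  have -> : x - (t *: w + (1 - t) *: p) = (x - p) - t *: (w - p).
    rewrite scalerBl scale1r scalerBr !opprD !opprK !addrA.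
    by congr (_ + _); rewrite addrAC.
  rewrite (norm_sqrB (x - p)) dotZr normrZ exprMn real_normK ?num_real// => E.
  by rewrite -(ler_pM2l t0); move: E; lra.
rewrite leNgt; apply/negP => k.
(* A step v with v |w - p|^2 < d contradicts tle, d being the supposed gap. *)
pose d := q + inner (x - p) (w - p) - r.
have d0 : 0 < d by rewrite subr_gt0.
have N0 : 0 <= `|w - p| ^+ 2 by exact: sqr_ge0.
have D0 : 0 < d + `|w - p| ^+ 2 + 1 by lra.
pose v := d / (d + `|w - p| ^+ 2 + 1).
have v0 : 0 < v by exact: divr_gt0.
have v1 : v < 1 by rewrite ltr_pdivrMr//; lra.
have vN : v * `|w - p| ^+ 2 < d.
  by rewrite /v mulrAC ltr_pdivrMr// ltr_pM2l//; lra.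
have := tle v v0 v1; move: vN; rewrite /d; have := mulr_ge0 (ltW v0) N0; lra.
Qed.

(** The hypothesis says that the affine functions aff x bound one another at the
    points P z, so their supremum h equals phi z at P z and has x - P x as a
    subgradient at P x; a supremum of continuous affine functions is convex and
    lower semi-continuous for free. *)
Lemma proximity_operator_of_subgradients P (phi : X -> R) :
  (forall x z, phi x + inner (x - P x) (P z - P x) <= phi z) ->
  is_proximity_operator P.
Proof.
move=> phiP.
pose aff x y : R := phi x + inner (x - P x) (y - P x).
pose h (y : X) : \bar R := ereal_sup (range (fun x => (aff x y)%:E)).
have aff_le x y : ((aff x y)%:E <= h y)%E.
  by apply: ereal_sup_ubound; exists x.
have hP z : h (P z) = (phi z)%:E.
  apply/eqP; rewrite eq_le; apply/andP; split.
    by apply: ge_ereal_sup => _ [x _ <-]; rewrite lee_fin phiP.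
  by apply: le_trans (aff_le z _); rewrite /aff subrr dot0r addr0.
have h_growth x y :
    ((2^-1 * `|x - P x| ^+ 2 + phi x + 2^-1 * `|y - P x| ^+ 2)%:E <=
     (2^-1 * `|x - y| ^+ 2)%:E + h y)%E.
  apply: le_trans (leeD2l _ (aff_le x y)); rewrite -EFinD lee_fin /aff.
  have -> : x - y = (x - P x) - (y - P x) by rewrite opprB addrA subrK.
  by rewrite (norm_sqrB (x - P x)); lra.
exists h; first split.
- split=> [y|]; first exact: lt_le_trans (ltNyr _) (aff_le 0 y).
  by exists (P 0); rewrite hP ltry.
- move=> y z t t0 t1; apply: ge_ereal_sup => _ [x _ <-].
  have -> : aff x (t *: y + (1 - t) *: z) = t * aff x y + (1 - t) * aff x z.
    by rewrite /aff !innerBr dotDr !dotZr; ring.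
  rewrite EFinD !EFinM leeD// lee_wpmul2l ?lee_fin//; first exact: ltW.
  by rewrite subr_ge0 ltW.
- move=> y a /ereal_sup_gt[_ [x _ <-]]; rewrite lte_fin => ay.
  have d0 : 0 < (aff x y - a) / (`|x - P x| + 1).
    by rewrite divr_gt0 ?subr_gt0// ltr_wpDl.
  exists (ball y ((aff x y - a) / (`|x - P x| + 1))); first exact: nbhsx_ballx.
  move=> z; rewrite -ball_normE/= => yz.
  apply: lt_le_trans (aff_le x z); rewrite lte_fin.
  have xP : 0 < `|x - P x| + 1 by rewrite ltr_wpDl.
  move: yz; rewrite ltr_pdivlMr// => yz.
  have -> : aff x z = aff x y - inner (x - P x) (y - z).
    by rewrite /aff !innerBr; lra.
  have := ler_norm (inner (x - P x) (y - z)).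
  have := inner_le_norm (x - P x) (y - z).
  have := normr_ge0 (y - z); lra.
- move=> x; apply/seteqP; split=> [y /= /(_ (P x))|_ -> y] /=; last first.
    apply: le_trans (h_growth x y); rewrite hP -EFinD lee_fin lerDl.
    by rewrite mulr_ge0// sqr_ge0.
  move/(le_trans (h_growth x y)); rewrite hP -EFinD lee_fin gerDl.
  rewrite pmulr_rle0 ?invr_gt0// => yP.
  apply/eqP; rewrite -subr_eq0 -normr_eq0 -sqrf_eq0 eq_le yP.
  exact: sqr_ge0.
Qed.

End proximity.

(** * Soft shrinkage and the l1 norm *)

Section soft_shrinkage_theory.
Context {R : realType}.

Lemma soft_abs_subgradient (lam t w : R) : 0 <= lam ->
  lam * `|soft lam t| + (t - soft lam t) * (w - soft lam t) <= lam * `|w|.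
Proof.
move=> lam0; have w1 := ler_norm w; have w2 := ler_norm (- w).
rewrite normrN in w2; rewrite /soft; case: ltP => [h|h].
  by rewrite ger0_norm; nra.
case: ltP => [h'|h']; last by rewrite normr0; case: (lerP 0 w) => w0; nra.
by rewrite ler0_norm; nra.
Qed.

(** This bound puts soft_l2 lam c in l1 for every c in l2; for
    |t| > lam it is the inequality (|t| - 2 lam)^2 >= 0. *)
Lemma soft_abs_le_sqr (lam t : R) : 0 <= lam ->
  4 * lam * `|soft lam t| <= t ^+ 2.
Proof.
move=> lam0; rewrite /soft; case: ltP => [h|h].
  by rewrite ger0_norm; [have := sqr_ge0 (t - 2 * lam); nra|lra].
case: ltP => [h'|h']; last by rewrite normr0 mulr0 sqr_ge0.
by rewrite ler0_norm; [have := sqr_ge0 (t + 2 * lam); nra|lra].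
Qed.

Lemma l1_norm_lim (c : l2 R) : cvgn (series (fun k => `|c k|)) ->
  l1_norm c = (limn (series (fun k => `|c k|)))%:E.
Proof.
move=> cc; rewrite /l1_norm -EFin_lim//.
by congr (limn _); apply/funext => n; rewrite /= /series/= -sumEFin.
Qed.

Lemma l1_norm_ge_sum (c : l2 R) n :
  ((series (fun k => `|c k|) n)%:E <= l1_norm c)%E.
Proof.
rewrite /series/= -sumEFin; apply: nneseries_lim_ge => k _ _.
by rewrite lee_fin.
Qed.

(** The partial sums of the coordinatewise inequality stay below
    lam * l1_norm w, and its left-hand side converges in R because p is
    in l1 and inner products converge; the case l1_norm w = +oo is trivial. *)
Lemma soft_l1_subgradient (lam : R) (c : l2 R) : 0 < lam ->
  let p := soft_l2 lam c in
  (lam%:E * l1_norm p)%E \is a fin_num /\ forall w,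
  (lam%:E * l1_norm p + (inner (c - p) (w - p))%:E <= lam%:E * l1_norm w)%E.
Proof.
move=> lam0 p; have pE k : p k = soft lam (c k) by rewrite soft_l2E// ltW.
have cp : cvgn (series (fun k => `|p k|)).
  apply: (@series_le_cvg _ _ (fun k => (4 * lam)^-1 * c k ^+ 2)) => [k|k|k|].
  - by [].
  - by rewrite mulr_ge0 ?sqr_ge0// invr_ge0 mulr_ge0// ltW.
  - rewrite pE mulrC ler_pdivlMr ?mulr_gt0// mulrC.
    exact: soft_abs_le_sqr (ltW lam0).
  - exact: (is_cvg_seriesZ (@l2_sqr_cvg _ c)).
rewrite (l1_norm_lim cp); split=> // w.
have := @l1_norm_ge_sum w; case: (l1_norm w) => [r| |] wr; last first.
- by have := wr 0%N; rewrite leeNy_eq.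
- by rewrite gt0_muley ?lte_fin// leey.
rewrite -!EFinM -EFinD lee_fin l2_innerE.
have cd := @l2_dot_cvg _ (c - p) (w - p).
have cl := @is_cvg_seriesZ _ _ lam cp.
rewrite -[X in X + _](lim_seriesZ lam cp) -[leLHS](lim_seriesD cl cd).
apply: limr_le; first exact: (is_cvg_seriesD cl cd).
apply: nearW => n.
apply: (@le_trans _ _ (lam * series (fun k => `|w k|) n)); last first.
  by rewrite ler_pM2l// -lee_fin wr.
rewrite /series/= mulr_sumr; apply: ler_sum => k _.
by have := soft_abs_subgradient (c k) (w k) (ltW lam0); rewrite -pE.
Qed.

End soft_shrinkage_theory.

(** * Proximity operators pulled back along an analysis operator *)

Section renormed_proximity.
Context {R : realType} {H : hilbertType R} (T : analysis_operator H).
Hypothesis T_neq0 : exists x, T x != 0.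
Local Notation HT := (renormed T).

Lemma proximity_operator_pullback (Prox : l2 R -> l2 R) :
  is_proximity_operator Prox ->
  is_proximity_operator (fun x : HT => (mp_inverse T (Prox (T x)) : HT)).
Proof.
move=> [h hG hP]; pose s := opnorm T ^+ 2.
have s0 : 0 < s by exact: opnorm_sqr_gt0.
pose p x := Prox (T x); pose u x := mp_inverse T (p x).
pose a x := T (u x) - p x.
have aT x y : inner (a x) (T y) = 0 by exact: mp_inverseP.
have sub x : h (p x) \is a fin_num /\
    forall w, (h (p x) + (inner (T x - p x) (w - p x))%:E <= h w)%E.
  by apply: argmin_subgradient => //; rewrite hP.
apply: (@proximity_operator_of_subgradients R HT _
  (fun x => (fine (h (p x)) + 2^-1 * `|a x| ^+ 2) / s)) => x z /=.
rewrite renormed_innerE -mulrDl ler_pM2r ?invr_gt0//.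
have := (sub x).2 (p z); rewrite -(fineK (sub x).1) -(fineK (sub z).1).
rewrite -EFinD lee_fin.
move=> h_sub; rewrite !(analysisB T).
by apply: subgradient_proj h_sub; rewrite -analysisB aT.
Qed.

(** The subgradient inequality bounds every competitor w in the infimum from
    below ([proj_growth]), which gives quadratic growth of the objective away
    from u = T^+ p in terms of T y - T u; the competitor w = p attains the bound
    at u.  The infimum need not be attained at the other points. *)
Lemma argmin_infconv_pullback (g : l2 R -> \bar R) (x : HT) (p : l2 R) :
  g p \is a fin_num ->
  (forall w, (g p + (inner (T x - p) (w - p))%:E <= g w)%E) ->
  argmin (fun y : HT => ((2^-1 * `|x - y| ^+ 2)%:E +
    ((opnorm T ^+ 2)^-1)%:E *
       infconv g (fun c => (2^-1 * `|c| ^+ 2)%:E +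
                           indicator (null_space (adjoint T)) c) (T y))%E) =
  [set (mp_inverse T p : HT)].
Proof.
move=> gp gsub; set s := opnorm T ^+ 2; set I := infconv _ _.
have s0 : 0 < s by exact: opnorm_sqr_gt0.
pose q := fine (g p); have gpE : g p = q%:E by rewrite fineK.
pose u : HT := mp_inverse T p.
have aT y : inner (T u - p) (T y) = 0 by exact: mp_inverseP.
pose m := q + 2^-1 * `|T x - p| ^+ 2.
have normE (y : HT) : 2^-1 * `|x - y| ^+ 2 = s^-1 * (2^-1 * `|T x - T y| ^+ 2).
  by rewrite renormed_norm_sqr analysisB -/s mulrA [RHS]mulrC.
have growth (y : HT) : ((s^-1 * (m + 2^-1 * `|T y - T u| ^+ 2))%:E <=
    (2^-1 * `|x - y| ^+ 2)%:E + s^-1%:E * I (T y))%E.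
  have Il : ((m + 2^-1 * `|T y - T u| ^+ 2 - 2^-1 * `|T x - T y| ^+ 2)%:E
      <= I (T y))%E.
    apply: le_ereal_inf_tmp => _ [w _ <-].
    rewrite /indicator; case: asboolP => [/null_space_adjointP n|_]; last first.
      rewrite !addey ?leey//.
      apply/eqP => gw; have := gsub w.
      by rewrite gw gpE leeNy_eq.
    rewrite adde0; apply: le_trans (leeD2r _ (gsub w)).
    rewrite gpE -!EFinD lee_fin.
    apply: (proj_growth (u := T u)); first by rewrite -analysisB dotC n.
      by rewrite -analysisB dotC n.
    by rewrite -analysisB dotC aT.
  have -> : s^-1 * (m + 2^-1 * `|T y - T u| ^+ 2) = 2^-1 * `|x - y| ^+ 2 +
      s^-1 * (m + 2^-1 * `|T y - T u| ^+ 2 - 2^-1 * `|T x - T y| ^+ 2).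
    by rewrite normE; ring.
  by rewrite EFinD leeD2l// EFinM lee_wpmul2l// lee_fin invr_ge0 ltW.
(* The infimum defining I (T u) is reached at p, as T u - p is orthogonal to the
   range of T. *)
have attained :
    ((2^-1 * `|x - u| ^+ 2)%:E + s^-1%:E * I (T u) <= (s^-1 * m)%:E)%E.
  have Iu : (I (T u) <= (q + 2^-1 * `|T u - p| ^+ 2)%:E)%E.
    apply: ereal_inf_lbound; exists p => //=.
    rewrite /indicator asboolT; last exact/null_space_adjointP.
    by rewrite adde0 gpE.
  have -> : s^-1 * m =
      2^-1 * `|x - u| ^+ 2 + s^-1 * (q + 2^-1 * `|T u - p| ^+ 2).
    have xp : `|T x - p| ^+ 2 = `|T x - T u| ^+ 2 + `|T u - p| ^+ 2.
      by apply: pythagoras; rewrite -analysisB dotC aT.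
    have split_sqr (b d e : R) : b = d + e ->
        s^-1 * (q + 2^-1 * b) = s^-1 * (2^-1 * d) + s^-1 * (q + 2^-1 * e).
      by move=> ->; ring.
    by rewrite (normE u); exact: split_sqr xp.
  by rewrite EFinD leeD2l// EFinM lee_wpmul2l// lee_fin invr_ge0 ltW.
apply/seteqP; split=> [y /= /(_ u)|_ -> y] /=.
  move=> /(le_trans (growth y))/le_trans/(_ attained).
  rewrite lee_fin ler_pM2l ?invr_gt0// gerDl pmulr_rle0 ?invr_gt0// => yu.
  have : T (y - u) = 0.
    apply/eqP; rewrite analysisB -normr_eq0 -sqrf_eq0 eq_le yu.
    exact: sqr_ge0.
  by move/analysis_inj/subr0_eq.
apply: le_trans attained (le_trans _ (growth y)).
by rewrite lee_fin ler_pM2l ?invr_gt0// lerDl mulr_ge0// sqr_ge0.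
Qed.

End renormed_proximity.

Theorem corollary4p2 (R : realType) (H : hilbertType R)
    (T : analysis_operator H) :
  separable H ->
  (exists x : H, T x != 0) ->
  (forall Prox : l2 R -> l2 R, is_proximity_operator Prox ->
    is_proximity_operator
      (fun x : renormed T => (mp_inverse T (Prox (T x)) : renormed T))) /\
  (forall lam : R, 0 < lam ->
    let f (y : renormed T) : \bar R :=
      (((opnorm T ^+ 2)^-1)%:E *
       infconv (fun c : l2 R => lam%:E * l1_norm c)
               (fun c : l2 R => (2^-1 * `|c| ^+ 2)%:E +
                                indicator (null_space (adjoint T)) c)
               (T y))%E in
    forall x : renormed T,
      argmin (fun y : renormed T => ((2^-1 * `|x - y| ^+ 2)%:E + f y)%E) =
      [set (mp_inverse T (soft_l2 lam (T x)) : renormed T)]).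
Proof.
move=> _ T_neq0; split=> [Prox|lam lam0 f x].
  exact: proximity_operator_pullback.
have [p_fin p_sub] := soft_l1_subgradient (T x) lam0.
exact: argmin_infconv_pullback.
Qed.
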